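(* Let $m,k\ge 1$ be integers, let $r$ be a route that is feasible with respect to the capacity constraint (its total number of collected items is at most $Q=mk$), and let $S_r=(b_1,b_2,\ldots,b_s)$ be the corresponding sequence of individual collected items. Then $S_r$ is feasible with respect to the fragility constraint if and only if, for all $i\in\{1,\ldots,s\}$ with $b_i\in\mathcal{L}$, either $$a^{\mathcal{H}}(i)+F(a^{\mathcal{L}}(i))\ge k$$ or $$a^{\mathcal{H}}(s)-a^{\mathcal{H}}(i)\le U(i),$$ where $U(i)=mk-\bigl(l(i)-(l(i)\bmod k)+k\bigr)$.
   Context: A vehicle has $m$ identical stacks $M=\{1,\ldots,m\}$, each with $k$ positions (height $k$); its capacity is $Q=km$. The customer set $\mathcal{N}_c=\{1,\ldots,n\}$ is partitioned into $\mathcal{L}$ (customers with fragile, ''light'', items) and $\mathcal{H}$ (customers with non-fragile, ''heavy'', items). Each customer $i$ has an integer demand of $q_i$ items to be picked up, all of the same type (fragile if $i\in\mathcal{L}$, non-fragile if $i\in\mathcal{H}$). A route $r=(v_0,v_1,\ldots,v_p,v_{p+1})$ starts and ends at the depot ($v_0=0$, $v_{p+1}=n+1$) and visits customers $v_1,\ldots,v_p$ in this order, picking up all items of each visited customer. The route induces the sequence of individual items $S_r=(b_1,\ldots,b_s)$ in the order in which they are collected (the order among items of one customer is irrelevant). By abuse of notation, $b_i\in\mathcal{L}$ (resp. $b_i\in\mathcal{H}$) means that item $b_i$ is fragile (resp. non-fragile). Loading rules: items are loaded in the order of the sequence; each item is put on top of the items already in one of the stacks and occupies one position; no rearrangement is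 ever allowed. The fragility constraint requires that no non-fragile item is placed above a fragile item in the same stack (fragile items may be placed on top of fragile or non-fragile items). Thus $S_r$ is feasible with respect to the fragility constraint if and only if there is an assignment $\sigma:\{1,\ldots,s\}\to M$ such that each stack receives at most $k$ items and there are no $i<j$ with $\sigma(i)=\sigma(j)$, $b_i\in\mathcal{L}$ and $b_j\in\mathcal{H}$. Notation: $a^{\mathcal{L}}(i)$ and $a^{\mathcal{H}}(i)$ are the numbers of fragile and non-fragile items, respectively, among $b_1,\ldots,b_i$; $l(i)=a^{\mathcal{L}}(i)+a^{\mathcal{H}}(i)$ (so $l(i)=i$). The modified modulo function is $F(x)=x\bmod k$ if $x\bmod k\neq 0$, and $F(x)=k$ otherwise. *)

(* Defs.v *)
From mathcomp Require Import all_boot all_order all_algebra.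

Set Implicit Arguments.
Unset Strict Implicit.
Unset Printing Implicit Defensive.

(* Vertices are 0, ..., n+1: the depot is both 0 (start) and n+1 (end), and the
   customers are 1, ..., n. *)
Notation vertex n := 'I_n.+2 (only parsing).

Definition customers (n : nat) : {set vertex n} :=
  [set v : vertex n | 0 < v < n.+1].

(* Visits are not required to be pairwise distinct, so elementary routes are a
   special case. *)
Definition is_route (n : nat) (r : seq (vertex n)) : Prop :=
  exists2 vs : seq (vertex n),
    all [in customers n] vs & r = ord0 :: rcons vs ord_max.

(* An item is represented by the customer it is collected from, so "b is
   fragile" is literally b \in L.  Only the demands of customers are used. *)
Definition items (n : nat) (q : vertex n -> nat) (r : seq (vertex n)) :
    seq (vertex n) :=
  flatten [seq nseq (q v) v | v <- r & v \in customers n].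

(* The items b_1, ..., b_s are 0-based here: item j : 'I_s stands for
   b_(j+1). *)
Definition fragility_feasible (n : nat) (L H : {set vertex n}) (m k : nat)
    (S : seq (vertex n)) : Prop :=
  exists sigma : 'I_(size S) -> 'I_m,
    (forall t : 'I_m, #|[set j | sigma j == t]| <= k) /\
    ~ (exists i j : 'I_(size S),
         [/\ i < j, sigma i = sigma j,
             tnth (in_tuple S) i \in L & tnth (in_tuple S) j \in H]).

(* Number of items of type A among b_1, ..., b_i. *)
Definition nb_items (n : nat) (A : {set vertex n}) (S : seq (vertex n))
    (i : nat) : nat :=
  count [in A] (take i S).

Definition modF (k x : nat) : nat := if x %% k != 0 then x %% k else k.

(* Integer-valued, since it may be negative (it is -k when l = m * k). *)
Definition Ubound (m k l : nat) : int :=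
  ((m * k)%:Z - (l%:Z - (l %% k)%:Z + k%:Z))%R.

(* Main.v *)
Require Import Defs.
From mathcomp Require Import all_boot all_order all_algebra.
From mathcomp Require Import zify.

(** View the vehicle as [m * k] numbered slots, slot [x] lying in stack
    [x %/ k].

    Necessity.  Let [a] fragile items be loaded when a fragile item has just
    been picked up.  As a stack holds at most [k] items, they occupy at least
    [ceil (a / k)] stacks.  All later non-fragile items must avoid these stacks,
    so there are at most [(m - ceil (a / k)) * k] of them
    ([feasible_closed_stacks]).  When [aH + F a < k], this bound is exactly [U]
    ([load_conditionE]).

    Sufficiency.  Put the fragile items, in order of collection, into slots
    0, 1, 2, ... and the non-fragile items, in order of collection, into the
    last slots of the vehicle, so that the last one gets slot [m * k - 1].  By
    the capacity constraint no slot is used twice.  A conflict would be the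
    [a]-th fragile item and a later non-fragile item sharing a stack, so the
    latter would have a slot below [ceil (a / k) * k].  If [aH + F a >= k], at
    least [aH] non-fragile items and [a] fragile ones have smaller slots, and
    [a + aH >= a + k - F a = ceil (a / k) * k].  Otherwise the bound by [U] says
    that even the first non-fragile item picked up later has a slot of at least
    [ceil (a / k) * k].  Both are contradictions
    ([load_condition_feasible]). *)

Set Implicit Arguments.
Unset Strict Implicit.
Unset Printing Implicit Defensive.

(** * Arithmetic of the loading condition *)

(** [modF k] is the remainder in the division with remainders 1, ..., k; the
    quotient is then [ceil (a / k) - 1], which is written [a.-1 %/ k]. *)
Lemma modF_divn k a : 0 < k -> 0 < a -> a = a.-1 %/ k * k + modF k a.
Proof.
case: a => // a k0 _ /=; rewrite /modF.
have e := divn_eq a k; have lt := ltn_pmod a k0.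
set u := a %/ k in e *; set v := a %% k in e lt.
have ek : a.+1 = u * k + v.+1 by lia.
rewrite ek modnMDl; have [ltv|gev] := ltnP v.+1 k.
  by rewrite modn_small.
have -> : v.+1 = k by lia.
by rewrite modnn.
Qed.

(** If [h + F a < k], then [a] and [a + h] have the same number of complete
    blocks of size [k], so [U] is the capacity of the [m - ceil (a / k)]
    remaining stacks. *)
Lemma Ubound_ceil m k a h : 0 < k -> 0 < a -> h + modF k a < k ->
  Ubound m k (a + h) = ((m * k)%:Z - ((a.-1 %/ k).+1 * k)%:Z)%R.
Proof.
move=> k0 a0 lt; have e := modF_divn k0 a0.
have em : (a + h) %% k = h + modF k a.
  by rewrite {1}e -addnA modnMDl addnC modn_small // addnC.
by rewrite /Ubound em; lia.
Qed.

(** The condition on a fragile item in terms of stacks: either the spare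
    positions of the [ceil (a / k)] stacks can be filled by the non-fragile
    items collected so far, or the later ones fit in the other stacks. *)
Lemma load_conditionE m k a h hs : 0 < k -> 0 < a -> h <= hs ->
  (k <= h + modF k a \/ (hs%:Z - h%:Z <= Ubound m k (a + h))%R) <->
  (k <= h + modF k a \/ (hs - h) + (a.-1 %/ k).+1 * k <= m * k).
Proof.
move=> k0 a0 hhs; have [ge|lt] := leqP k (h + modF k a); first by split; left.
by rewrite Ubound_ceil //; split=> -[//|le]; right; lia.
Qed.

(** * Counting in prefixes *)

Section Prefix.

Variables (T : Type) (P : pred T).
Implicit Type S : seq T.

Lemma leq_count_take S i j : i <= j -> count P (take i S) <= count P (take j S).
Proof.
move=> le; rewrite -(minn_idPl le) take_min.
by rewrite -[in leqRHS](cat_take_drop i (take j S)) count_cat leq_addr.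
Qed.

Lemma leq_count_take_all S i : count P (take i S) <= count P S.
Proof. by rewrite -{2}(cat_take_drop i S) count_cat leq_addr. Qed.

Lemma count_takeS S (j : 'I_(size S)) :
  count P (take j.+1 S) = count P (take j S) + P (tnth (in_tuple S) j).
Proof.
have x0 := tnth (in_tuple S) j.
by rewrite (take_nth x0) // -cats1 count_cat /= addn0 (tnth_nth x0).
Qed.

Lemma ltn_count_take S (i : 'I_(size S)) j :
  i < j -> P (tnth (in_tuple S) i) ->
  count P (take i S) < count P (take j S).
Proof.
by move=> lt Pi; have := leq_count_take S lt; rewrite count_takeS Pi addn1.
Qed.

Lemma ltn_count_take_all S (i : 'I_(size S)) :
  P (tnth (in_tuple S) i) -> count P (take i S) < count P S.
Proof.
move=> Pi; rewrite -[in ltnRHS](take_size S).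
exact: ltn_count_take.
Qed.

(** For an item satisfying [P], [count P (take j S)] is its rank among the items
    satisfying [P]; this makes the slots of the loading plan distinct. *)
Lemma count_take_inj S (i j : 'I_(size S)) :
  P (tnth (in_tuple S) i) -> P (tnth (in_tuple S) j) ->
  count P (take i S) = count P (take j S) -> i = j.
Proof.
move=> Pi Pj e; apply: val_inj; case: (ltngtP i j) => // lt.
  by have := ltn_count_take lt Pi; rewrite e ltnn.
by have := ltn_count_take lt Pj; rewrite e ltnn.
Qed.

Lemma count_card S : count P S = #|[set j | P (tnth (in_tuple S) j)]|.
Proof.
by rewrite cardsE -sum1_card -sum1_count [LHS](big_tnth _ _ S).
Qed.

Lemma count_take_card S i :
  count P (take i S) =
  #|[set j : 'I_(size S) | (j < i) && P (tnth (in_tuple S) j)]|.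
Proof.
elim: i => [|i IH]; first by rewrite take0 eq_card0 // => j; rewrite inE.
have [lt|ge] := ltnP i (size S); last first.
  have -> : take i.+1 S = take i S by rewrite !take_oversize // leqW.
  rewrite IH; apply: eq_card => j; rewrite !inE.
  by rewrite (leq_trans (ltn_ord j) ge) (leq_trans (ltn_ord j) (leqW ge)).
pose o := Ordinal lt; rewrite (count_takeS o) IH [RHS](cardsD1 o).
rewrite inE /= leqnn /= addnC; congr (_ + _).
by apply: eq_card => j; rewrite !inE ltnS -val_eqE /=; case: (ltngtP (val j) i).
Qed.

Lemma count_drop_card S i :
  count P S - count P (take i S) =
  #|[set j : 'I_(size S) | (i <= j) && P (tnth (in_tuple S) j)]|.
Proof.
rewrite count_card count_take_card -cardsDS.
  by apply: eq_card => j; rewrite !inE; case: ltnP; case: (P _).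
by apply/subsetP=> j; rewrite !inE => /andP[].
Qed.

End Prefix.

(** * Stacks of bounded height *)

Section Stacks.

Variables (I : finType) (k : nat).

Lemma card_fibers_leq (J : finType) (f : I -> J) (B : {set J}) (A : {set I}) :
  (forall t, #|[set x | f x == t]| <= k) ->
  {in A, forall x, f x \in B} -> #|A| <= #|B| * k.
Proof.
move=> fk AB; rewrite -sum1_card (partition_big f (mem B)) //=.
rewrite -sum_nat_const; apply: leq_sum => t _.
rewrite sum1_card; apply: leq_trans (fk t); apply: subset_leq_card.
by apply/subsetP=> x; rewrite !inE => /andP[].
Qed.

(** An item is determined by its stack [f x %/ k] and its height [f x %% k]. *)
Lemma card_fiber_divn (f : I -> nat) t : 0 < k -> injective f ->
  #|[set x | f x %/ k == t]| <= k.
Proof.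
move=> k0 fI; rewrite -[leqRHS]card_ord.
apply: (@leq_card_in _ _ (fun x => Ordinal (ltn_pmod (f x) k0))).
move=> x y; rewrite !inE => /eqP ex /eqP ey [e].
by apply: fI; rewrite (divn_eq (f x) k) (divn_eq (f y) k) ex ey e.
Qed.

End Stacks.

(** * Feasible loadings *)

Section Loading.

Variables (n m k : nat) (L H : {set vertex n}) (S : seq (vertex n)).
Hypothesis k_gt0 : 0 < k.

Let item := tnth (in_tuple S).

Lemma leq_nb_items (A : {set vertex n}) i j :
  i <= j -> nb_items A S i <= nb_items A S j.
Proof. exact: leq_count_take. Qed.

Lemma nb_items_le_total (A : {set vertex n}) i :
  nb_items A S i <= count [in A] S.
Proof. exact: leq_count_take_all. Qed.

Lemma nb_items_lt_total (A : {set vertex n}) j :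
  item j \in A -> nb_items A S j < count [in A] S.
Proof. exact: (ltn_count_take_all (P := [in A])). Qed.

Lemma nb_items_inj (A : {set vertex n}) i j : item i \in A -> item j \in A ->
  nb_items A S i = nb_items A S j -> i = j.
Proof. exact: (count_take_inj (P := [in A])). Qed.

Lemma nb_itemsS (A : {set vertex n}) j :
  item j \in A -> nb_items A S j.+1 = (nb_items A S j).+1.
Proof. by move=> jA; rewrite /nb_items count_takeS jA addn1. Qed.

(** A stack holding a fragile item among the first [i] items is closed to the
    non-fragile items after them. *)
Lemma feasible_closed_stacks i : fragility_feasible L H m k S ->
  0 < nb_items L S i ->
  (count [in H] S - nb_items H S i) + ((nb_items L S i).-1 %/ k).+1 * k
    <= m * k.
Proof.
move=> [sigma [fk noconf]] a0.
pose A := [set j : 'I_(size S) | (j < i) && (item j \in L)].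
pose D := [set j : 'I_(size S) | (i <= j) && (item j \in H)].
pose C := sigma @: A.
have cA : #|A| <= #|C| * k.
  by apply: (card_fibers_leq fk) => j jA; apply: imset_f.
have cD : #|D| <= #|~: C| * k.
  apply: (card_fibers_leq fk) => j; rewrite inE => /andP[ij jH].
  rewrite inE; apply/negP=> /imsetP[x]; rewrite inE => /andP[xi xL] e.
  by apply: noconf; exists x, j; split=> //; apply: leq_trans ij.
have ceil : (nb_items L S i).-1 %/ k < #|C|.
  rewrite ltn_divLR // -ltnS prednK //.
  by rewrite /nb_items count_take_card ltnS.
have cC : #|C| + #|~: C| = m by rewrite cardsC card_ord.
rewrite /nb_items count_drop_card -cC mulnDl addnC.
by apply: leq_add cD; rewrite leq_mul2r ceil orbT.
Qed.

(** The two kinds start at opposite ends of the vehicle, so only the stack of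
    the last fragile item can contain both; unused slots lie in between. *)
Definition slot (j : 'I_(size S)) : nat :=
  if item j \in L then nb_items L S j
  else m * k - count [in H] S + nb_items H S j.

Hypothesis LH_S : {in S, forall v, (v \in H) = (v \notin L)}.
Hypothesis capacity : size S <= m * k.

Lemma item_H j : (item j \in H) = (item j \notin L).
Proof. exact/LH_S/mem_tnth. Qed.

Lemma count_LH : count [in L] S + count [in H] S = size S.
Proof.
by rewrite -(count_predC [in L] S); congr (_ + _); apply: eq_in_count.
Qed.

Lemma slot_bound j : slot j < m * k.
Proof.
have c := count_LH; rewrite /slot; case: ifPn => [jL|].
  by have := nb_items_lt_total jL; lia.
by rewrite -item_H => jH; have := nb_items_lt_total jH; lia.
Qed.

Lemma slot_inj : injective slot.
Proof.
have c := count_LH; move=> i j; rewrite /slot.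
case: ifPn => [iL|iL]; case: ifPn => [jL|jL] e.
- exact: nb_items_inj e.
- by have := nb_items_lt_total iL; lia.
- by have := nb_items_lt_total jL; lia.
- by move/addnI: e; apply: nb_items_inj; rewrite item_H.
Qed.

Lemma load_condition_feasible :
  (forall i : 'I_(size S), item i \in L ->
     k <= nb_items H S i.+1 + modF k (nb_items L S i.+1) \/
     (count [in H] S - nb_items H S i.+1)
       + ((nb_items L S i.+1).-1 %/ k).+1 * k <= m * k) ->
  fragility_feasible L H m k S.
Proof.
move=> cond.
have stack_bound j : slot j %/ k < m by rewrite ltn_divLR ?slot_bound.
exists (fun j => Ordinal (stack_bound j)); split=> [t|].
  have := card_fiber_divn t k_gt0 slot_inj; apply: leq_trans.
  by apply: subset_leq_card; apply/subsetP=> j; rewrite !inE -val_eqE.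
move=> [i [j [lt_ij [same] iL jH]]].
have c := count_LH.
have ea := nb_itemsS iL.
have a0 : 0 < nb_items L S i.+1 by rewrite ea.
have leL := nb_items_le_total L i.+1.
have leH := leq_nb_items H lt_ij.
have ltH := nb_items_lt_total jH.
(* The slot of [j] is below the top of the stack of [i]. *)
have : slot j < ((nb_items L S i.+1).-1 %/ k).+1 * k.
  by rewrite -ltn_divLR // -same ea /= /slot iL.
have := jH; rewrite [_ \in H]item_H /slot => /negPf ->.
have e := modF_divn k_gt0 a0.
by case: (cond i iL); lia.
Qed.

End Loading.

Lemma items_customers n (q : vertex n -> nat) r :
  {subset items q r <= customers n}.
Proof.
move=> x /flattenP[s /mapP[v]]; rewrite mem_filter => /andP[vc _] ->.
by rewrite mem_nseq => /andP[_ /eqP ->].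
Qed.

Theorem proposition3p1 (n m k : nat) (hm : 1 <= m) (hk : 1 <= k)
    (L H : {set vertex n})
    (hLH : L :|: H = customers n) (hdisj : [disjoint L & H])
    (q : vertex n -> nat) (r : seq (vertex n)) (hr : is_route r) :
  let S := items q r in
  let s := size S in
  let aL := nb_items L S in
  let aH := nb_items H S in
  let l := fun i : nat => aL i + aH i in
  s <= m * k ->
  fragility_feasible L H m k S <->
  (forall i : nat, 1 <= i <= s -> nth ord0 S i.-1 \in L ->
     k <= aH i + modF k (aL i) \/
     ((aH s)%:Z - (aH i)%:Z <= Ubound m k (l i))%R).
Proof.
move=> S s aL aH l cap.
have LH_S : {in S, forall v, (v \in H) = (v \notin L)}.
  move=> v /items_customers; rewrite -hLH inE.
  by case: (boolP (v \in L)) => [vL _|//]; rewrite (disjointFr hdisj vL).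
have aHs : aH s = count [in H] S by rewrite /aH /nb_items take_size.
have leH i : aH i <= aH s by rewrite aHs; apply: nb_items_le_total.
have aL_gt0 (i : 'I_s) : tnth (in_tuple S) i \in L -> 0 < aL i.+1.
  by move=> iL; rewrite /aL nb_itemsS.
split=> [feas [//|i] /= lt iL | cond].
  have a0 : 0 < aL i.+1.
    by apply: (aL_gt0 (Ordinal lt)); rewrite (tnth_nth ord0).
  apply/load_conditionE => //; right.
  by rewrite aHs; apply: feasible_closed_stacks.
apply: load_condition_feasible => // i iL.
rewrite -aHs; apply/load_conditionE; rewrite ?aL_gt0 //.
by apply: cond; [rewrite /= ltn_ord | rewrite (tnth_nth ord0) in iL].
Qed.
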